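(* Let $\mathcal{A}=(a_{ijk})$ be a 3rd order 3-dimensional real symmetric tensor with $a_{iii}>0$ for all $i\in\{1,2,3\}$. Suppose that $a_{123}\ge-\sqrt[3]{a_{111}a_{222}a_{333}}$ and that there exist $r,s,t\in\{1,2,3\}$ with $r\neq s$, $s\neq t$, $r\neq t$ such that $$a_{rss}\ge\sqrt[3]{a_{rrr}a_{sss}^2},\qquad a_{rtt}\ge\sqrt[3]{a_{rrr}a_{ttt}^2}$$ and one of the following five conditions holds: (1) $a_{rrs}\ge\sqrt[3]{a_{rrr}^2a_{sss}}$, $a_{rrt}\ge-\sqrt[3]{a_{rrr}^2a_{ttt}}$, $a_{sst}\ge-\sqrt[3]{a_{sss}^2a_{ttt}}$, $a_{stt}\ge\sqrt[3]{a_{sss}a_{ttt}^2}$; (2) $a_{rrs}\ge-\sqrt[3]{a_{rrr}^2a_{sss}}$, $a_{rrt}\ge0$, $a_{sst}\ge\sqrt[3]{a_{sss}^2a_{ttt}}$, $a_{stt}\ge\sqrt[3]{a_{sss}a_{ttt}^2}$; (3) $a_{rrs}\ge0$, $a_{rrt}\ge0$, $a_{sst}\ge\sqrt[3]{a_{sss}^2a_{ttt}}$, $a_{stt}\ge-\sqrt[3]{a_{sss}a_{ttt}^2}$; (4) $a_{rrs}\ge\sqrt[3]{a_{rrr}^2a_{sss}}$, $a_{rrt}\ge-\sqrt[3]{a_{rrr}^2a_{ttt}}$, $a_{sst}\ge0$, $a_{stt}\ge0$; (5) $a_{rrs}\ge0$, $a_{rrt}\ge0$, $a_{sst}\ge0$,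 $a_{stt}\ge0$. Then $\mathcal{A}$ is strictly copositive.
   Context: A 3rd order 3-dimensional real symmetric tensor is an array $\mathcal{A}=(a_{ijk})_{1\le i,j,k\le 3}$ of real numbers whose entries are invariant under every permutation of the indices. For $x=(x_1,x_2,x_3)^\top\in\mathbb{R}^3$ put $\mathcal{A}x^3=\sum_{i,j,k=1}^3 a_{ijk}x_ix_jx_k$. $\mathcal{A}$ is strictly copositive if $\mathcal{A}x^3>0$ for every $x\neq 0$ with $x_1,x_2,x_3\ge 0$. *)

(* Defs.v *)
From HB Require Import structures.
From mathcomp Require Import all_boot all_order all_algebra all_fingroup.
From mathcomp Require Import all_classical all_reals all_analysis.
Set Implicit Arguments.
Unset Strict Implicit.
Unset Printing Implicit Defensive.
Import Order.TTheory GRing.Theory Num.Theory.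
Local Open Scope ring_scope.

(* The real cube root. The sign is split off because the library's [powR] is
   meaningful only for nonnegative bases. *)
Definition cbrt (R : realType) (x : R) : R := Num.sg x * `|x| `^ 3^-1.

Definition tensor3 (R : realType) (n : nat) : Type :=
  'I_n -> 'I_n -> 'I_n -> R.

(* [i] is the triple of indices; [0 1 2 : 'I_3] are its positions. *)
Definition symmetric_tensor3 (R : realType) (n : nat) (A : tensor3 R n) : Prop :=
  forall (p : 'S_3) (i : 'I_3 -> 'I_n),
    A (i (p 0)) (i (p 1)) (i (p 2)) = A (i 0) (i 1) (i 2).

Definition cubic_form (R : realType) (n : nat) (A : tensor3 R n)
    (x : 'cV[R]_n) : R :=
  \sum_(i < n) \sum_(j < n) \sum_(k < n) A i j k * x i 0 * x j 0 * x k 0.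

Definition strictly_copositive (R : realType) (n : nat) (A : tensor3 R n) : Prop :=
  forall x : 'cV[R]_n, x != 0 -> (forall i, 0 <= x i 0) -> 0 < cubic_form A x.

(* Main.v *)
(* Scaling the variables by the cube roots of the diagonal entries makes the
   diagonal entries 1; the off-diagonal ones are then bounded below by 1, 0 or -1.
   Each of the five cases thus reduces to the positivity of one explicit ternary
   cubic, exhibited below by a sum-of-squares style certificate. *)

Require Import Defs.
From HB Require Import structures.
From mathcomp Require Import all_boot all_order all_algebra all_fingroup.
From mathcomp Require Import all_classical all_reals all_analysis.
From mathcomp Require Import ring lra.
Set Implicit Arguments.
Unset Strict Implicit.
Unset Printing Implicit Defensive.
Import Order.TTheory GRing.Theory Num.Theory.
Local Open Scope ring_scope.

(** * Real cube roots of nonnegative numbers *)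

Section CubeRoot.
Variable R : realType.
Implicit Types x y : R.

Lemma cbrtX3 x : 0 <= x -> cbrt x ^+ 3 = x.
Proof.
rewrite le_eqVlt => /predU1P[<-|x_gt0].
  by rewrite /cbrt sgr0 mul0r expr0n.
rewrite /cbrt gtr0_sg// mul1r gtr0_norm// -powR_mulrn ?powR_ge0//.
by rewrite -powRrM mulVf ?pnatr_eq0// powRr1// ltW.
Qed.

Lemma cbrt_ge0 x : 0 <= x -> 0 <= cbrt x.
Proof. by move=> x_ge0; rewrite mulr_ge0 ?powR_ge0// sgr_ge0. Qed.

Lemma X3cbrt x : 0 <= x -> cbrt (x ^+ 3) = x.
Proof.
move=> x_ge0; have x3_ge0 : 0 <= x ^+ 3 by rewrite exprn_ge0.
by apply: (pexpIrn (n := 3)) => //; rewrite ?nnegrE ?cbrt_ge0// cbrtX3.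
Qed.

Lemma cbrt_gt0 x : 0 < x -> 0 < cbrt x.
Proof.
move=> x_gt0; rewrite lt_def cbrt_ge0 ?ltW// andbT; apply/eqP => cx0.
have := cbrtX3 (ltW x_gt0); rewrite cx0 expr0n => x0.
by move: x_gt0; rewrite -x0 ltxx.
Qed.

(** Lets the diagonal entries be written as cubes, so that every bound in the hypotheses becomes a
    monomial. *)
Lemma gt0_cube_ex x : 0 < x -> exists2 a, 0 < a & x = a ^+ 3.
Proof.
by move=> x_gt0; exists (cbrt x); rewrite ?cbrt_gt0// cbrtX3// ltW.
Qed.

End CubeRoot.

(** * Positivity of the five normalised ternary cubics *)

Section TernaryCubics.
Variable R : realFieldType.
Implicit Types u v w : R.

Lemma cube_sum_gt0 u v w : 0 <= u -> 0 <= v -> 0 <= w -> 0 < u + v + w ->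
  0 < u ^+ 3 + v ^+ 3 + w ^+ 3.
Proof.
move=> u0 v0 w0 s0.
have u3 := exprn_ge0 3 u0; have v3 := exprn_ge0 3 v0.
have w3 := exprn_ge0 3 w0.
rewrite lt_def !addr_ge0// andbT; apply/eqP => /eqP.
rewrite !paddr_eq0 ?addr_ge0// !expf_eq0/=.
case/andP => /andP[/eqP u00 /eqP v00] /eqP w00.
by move: s0; rewrite u00 v00 w00 !addr0 ltxx.
Qed.

(** Monotonicity of the cube, applied to [- v <= u - v]: the difference of the two cubes is [u]
    times a sum of squares. *)
Lemma cube_sub_le u v : 0 <= u -> 0 <= v -> - v ^+ 3 <= (u - v) ^+ 3.
Proof.
move=> u0 v0; rewrite -subr_ge0.
have -> : (u - v) ^+ 3 - - v ^+ 3
  = u * (((u - v) - v / 2) ^+ 2 + 3 / 4 * v ^+ 2) by field.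
by rewrite mulr_ge0// addr_ge0 ?sqr_ge0// mulr_ge0 ?sqr_ge0//; lra.
Qed.

(** The form is [(u + v - w) ^+ 3 + 2 * w ^+ 3]. The first cube is at least [- w ^+ 3], which leaves
    [w ^+ 3]; for [w = 0] the form is [(u + v) ^+ 3]. *)
Lemma ternary_cubic1_gt0 u v w :
  0 <= u -> 0 <= v -> 0 <= w -> 0 < u + v + w ->
  0 < u ^+ 3 + v ^+ 3 + w ^+ 3 + 3 * (u * v ^+ 2) + 3 * (u * w ^+ 2)
      + 3 * (u ^+ 2 * v) - 3 * (u ^+ 2 * w) - 3 * (v ^+ 2 * w)
      + 3 * (v * w ^+ 2) - 6 * (u * v * w).
Proof.
move=> u0 v0 w0 s0.
have -> : u ^+ 3 + v ^+ 3 + w ^+ 3 + 3 * (u * v ^+ 2) + 3 * (u * w ^+ 2)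
      + 3 * (u ^+ 2 * v) - 3 * (u ^+ 2 * w) - 3 * (v ^+ 2 * w)
      + 3 * (v * w ^+ 2) - 6 * (u * v * w) = (u + v - w) ^+ 3 + 2 * w ^+ 3.
  by ring.
have [w_gt0|w_le0] := ltP 0 w.
  have := cube_sub_le (addr_ge0 u0 v0) w0.
  by have := exprn_gt0 3 w_gt0; lra.
have w00 : w = 0 by lra.
by rewrite w00 subr0 expr0n mulr0 addr0 exprn_gt0//; lra.
Qed.

Lemma ternary_cubic2_gt0 u v w :
  0 <= u -> 0 <= v -> 0 <= w -> 0 < u + v + w ->
  0 < u ^+ 3 + v ^+ 3 + w ^+ 3 + 3 * (u * v ^+ 2) + 3 * (u * w ^+ 2)
      - 3 * (u ^+ 2 * v) + 3 * (v ^+ 2 * w)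
      + 3 * (v * w ^+ 2) - 6 * (u * v * w).
Proof.
move=> u0 v0 w0 s0; set F := (X in 0 < X).
(* The argument below multiplies by [4 * (u + v)], so the case [u = v = 0] is settled first. *)
have [uv_gt0|uv_le0] := ltP 0 (u + v); last first.
  have [u00 v00] : u = 0 /\ v = 0 by split; lra.
  have -> : F = w ^+ 3 by rewrite /F u00 v00; ring.
  by rewrite exprn_gt0//; lra.
(* Completing the square in [w], the term [w ^+ 3] being left apart. *)
have E : 4 * (u + v) * F = 4 * (u + v) * w ^+ 3
    + 3 * (2 * (u + v) * w - v * (2 * u - v)) ^+ 2
    + (4 * (u * (u + 2 * v)) * (u - 2 * v) ^+ 2 + (v * (2 * u - v)) ^+ 2).
  by rewrite /F; ring.
have uv4 : 0 < 4 * (u + v) by lra.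
rewrite -(pmulr_rgt0 _ uv4) E.
have t1 : 0 <= 4 * (u + v) * w ^+ 3 by rewrite mulr_ge0 ?exprn_ge0// ltW.
have t2 : 0 <= 3 * (2 * (u + v) * w - v * (2 * u - v)) ^+ 2.
  by rewrite mulr_ge0// sqr_ge0.
(* There remains a binary quartic in [u] and [v]. Its two summands are nonnegative and vanish
   together only at the origin: for [u = 0] the second is [v ^+ 4], for [u = 2 * v] it is
   [(3 * v ^+ 2) ^+ 2], and otherwise the first is positive. *)
apply: ltr_wpDl; first exact: addr_ge0.
have t3 : 0 <= 4 * (u * (u + 2 * v)) by rewrite !mulr_ge0//; lra.
have [u00|u_neq0] := eqVneq u 0.
  have v_neq0 : v != 0.
    by apply/eqP => v00; move: uv_gt0; rewrite u00 v00 addr0 ltxx.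
  rewrite u00 mul0r mulr0 mul0r add0r exprn_even_gt0//= mulf_neq0//.
  by rewrite mulr0 sub0r oppr_eq0.
have u_gt0 : 0 < u by rewrite lt_def u_neq0.
have [E2|n2] := eqVneq (u - 2 * v) 0.
  rewrite E2 expr0n mulr0 add0r exprn_gt0//.
  by rewrite mulr_gt0//; lra.
apply: ltr_pwDl; last exact: sqr_ge0.
by rewrite pmulr_rgt0 ?exprn_even_gt0// !mulr_gt0//; lra.
Qed.

(** The terms divisible by [u], other than [u ^+ 3], form [3 * (u * (v - w) ^+ 2)]; the terms in [v]
    and [w] alone are [(w - v) ^+ 3 + 2 * v ^+ 3], at least [v ^+ 3]. *)
Lemma ternary_cubic3_gt0 u v w :
  0 <= u -> 0 <= v -> 0 <= w -> 0 < u + v + w ->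
  0 < u ^+ 3 + v ^+ 3 + w ^+ 3 + 3 * (u * v ^+ 2) + 3 * (u * w ^+ 2)
      + 3 * (v ^+ 2 * w) - 3 * (v * w ^+ 2) - 6 * (u * v * w).
Proof.
move=> u0 v0 w0 s0.
have -> : u ^+ 3 + v ^+ 3 + w ^+ 3 + 3 * (u * v ^+ 2) + 3 * (u * w ^+ 2)
      + 3 * (v ^+ 2 * w) - 3 * (v * w ^+ 2) - 6 * (u * v * w)
    = 3 * (u * (v - w) ^+ 2) + (u ^+ 3 + ((w - v) ^+ 3 + 2 * v ^+ 3)) by ring.
apply: ltr_wpDl; first by rewrite mulr_ge0// mulr_ge0// sqr_ge0.
have [v_gt0|v_le0] := ltP 0 v.
  have := cube_sub_le w0 v0; have := exprn_gt0 3 v_gt0.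
  by have := exprn_ge0 3 u0; lra.
have v00 : v = 0 by lra.
have := cube_sum_gt0 u0 v0 w0 s0.
by rewrite v00 subr0 expr0n mulr0 !addr0.
Qed.

(** Completing the square in [w], with [w ^+ 3] left apart, cancels every mixed term and leaves a
    quarter of [u ^+ 3]. *)
Lemma ternary_cubic4_gt0 u v w :
  0 <= u -> 0 <= v -> 0 <= w -> 0 < u + v + w ->
  0 < u ^+ 3 + v ^+ 3 + w ^+ 3 + 3 * (u * v ^+ 2) + 3 * (u * w ^+ 2)
      + 3 * (u ^+ 2 * v) - 3 * (u ^+ 2 * w) - 6 * (u * v * w).
Proof.
move=> u0 v0 w0 s0.
have -> : u ^+ 3 + v ^+ 3 + w ^+ 3 + 3 * (u * v ^+ 2) + 3 * (u * w ^+ 2)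
      + 3 * (u ^+ 2 * v) - 3 * (u ^+ 2 * w) - 6 * (u * v * w)
    = 3 * (u * (w - (u + 2 * v) / 2) ^+ 2)
      + (u ^+ 3 / 4 + v ^+ 3 + w ^+ 3) by field.
apply: ltr_wpDl; first by rewrite mulr_ge0// mulr_ge0// sqr_ge0.
have := cube_sum_gt0 u0 v0 w0 s0; have := exprn_ge0 3 u0.
by have := exprn_ge0 3 v0; have := exprn_ge0 3 w0; lra.
Qed.

Lemma ternary_cubic5_gt0 u v w :
  0 <= u -> 0 <= v -> 0 <= w -> 0 < u + v + w ->
  0 < u ^+ 3 + v ^+ 3 + w ^+ 3 + 3 * (u * v ^+ 2) + 3 * (u * w ^+ 2)
      - 6 * (u * v * w).
Proof.
move=> u0 v0 w0 s0.
have -> : u ^+ 3 + v ^+ 3 + w ^+ 3 + 3 * (u * v ^+ 2) + 3 * (u * w ^+ 2)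
      - 6 * (u * v * w)
    = 3 * (u * (v - w) ^+ 2) + (u ^+ 3 + v ^+ 3 + w ^+ 3) by ring.
by apply: ltr_wpDl; [rewrite mulr_ge0// mulr_ge0// sqr_ge0 |
  exact: cube_sum_gt0].
Qed.

End TernaryCubics.

(** * Reindexing by a triple of distinct indices *)

Section DistinctTriples.
Variables r s t : 'I_3.
Hypotheses (rs : r != s) (st : s != t) (rt : r != t).

Definition triple_fun (i : 'I_3) : 'I_3 := tnth [tuple r; s; t] i.

Lemma triple_fun_inj : injective triple_fun.
Proof.
by apply/injectiveP/injectiveP/tuple_uniqP; rewrite /= !inE negb_or rs rt st.
Qed.

Definition triple_perm : 'S_3 := perm triple_fun_inj.

Lemma triple_permE :
  [/\ triple_perm 0 = r, triple_perm 1 = s & triple_perm 2 = t].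
Proof. by split; rewrite permE. Qed.

(** Stated for any commutative law because it serves both for sums and for the product of the
    diagonal entries. *)
Lemma big_triple (T : Type) (idx : T) (op : Monoid.com_law idx)
    (F : 'I_3 -> T) :
  \big[op/idx]_i F i = op (F r) (op (F s) (F t)).
Proof.
have [p0 p1 p2] := triple_permE.
rewrite (reindex_inj (@perm_inj _ triple_perm)) !big_ord_recl big_ord0.
rewrite Monoid.mulm1.
have -> : lift ord0 ord0 = 1 :> 'I_3 by apply: val_inj.
have -> : lift ord0 (lift ord0 ord0) = 2 :> 'I_3 by apply: val_inj.
by rewrite p0 p1 p2.
Qed.

End DistinctTriples.

(** * Sorting the indices of a symmetric tensor *)

Section SymmetricTensor.
Variables (R : realType) (n : nat) (A : tensor3 R n).
Hypothesis symA : symmetric_tensor3 A.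

Lemma symmetric_tensor3_swap12 i j k : A j i k = A i j k.
Proof.
have := symA (tperm 0 1) (tnth [tuple i; j; k]).
by rewrite tpermL tpermR tpermD.
Qed.

Lemma symmetric_tensor3_swap23 i j k : A i k j = A i j k.
Proof.
have := symA (tperm 1 2) (tnth [tuple i; j; k]).
by rewrite tpermL tpermR tpermD.
Qed.

End SymmetricTensor.

Lemma cubic_form3E (R : realType) (A : tensor3 R 3) (x : 'cV[R]_3) r s t :
  symmetric_tensor3 A -> r != s -> s != t -> r != t ->
  cubic_form A x =
    A r r r * x r 0 ^+ 3 + A s s s * x s 0 ^+ 3 + A t t t * x t 0 ^+ 3
    + 3 * (A r s s * (x r 0 * x s 0 ^+ 2)) + 3 * (A r t t * (x r 0 * x t 0 ^+ 2))
    + 3 * (A r r s * (x r 0 ^+ 2 * x s 0)) + 3 * (A r r t * (x r 0 ^+ 2 * x t 0))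
    + 3 * (A s s t * (x s 0 ^+ 2 * x t 0)) + 3 * (A s t t * (x s 0 * x t 0 ^+ 2))
    + 6 * (A r s t * (x r 0 * x s 0 * x t 0)).
Proof.
move=> symA rs st rt; rewrite /cubic_form.
have sum3 (F : 'I_3 -> R) : \sum_i F i = F r + (F s + F t).
  exact: big_triple.
have s12 := symmetric_tensor3_swap12 symA.
have s23 := symmetric_tensor3_swap23 symA.
rewrite !sum3.
(* Adjacent swaps sort each index triple in the order [r], [s], [t]; [ring] then collects the 27
   terms into ten monomials. *)
rewrite (s12 r s r) (s23 r r s) (s12 r t r) (s23 r r t) (s12 s t s) (s23 s s t).
rewrite (s12 r s s) (s23 s r s) (s12 r s s) (s12 r t t) (s23 t r t) (s12 r t t).
rewrite (s12 s t t) (s23 t s t) (s12 s t t).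
rewrite (s23 r s t) (s23 s r t) (s12 r s t) (s23 t r s) (s12 r t s) (s23 r s t).
by ring.
Qed.

(* The paper's indices 1, 2, 3 are 0, 1, 2 : 'I_3. *)
Theorem corollary3p8 (R : realType) (A : tensor3 R 3)
  (symA : symmetric_tensor3 A)
  (diagA : forall i : 'I_3, 0 < A i i i)
  (A123 : A 0 1 2 >= - cbrt (A 0 0 0 * A 1 1 1 * A 2 2 2))
  (condA : exists r s t : 'I_3,
    [/\ r != s, s != t & r != t] /\
    (A r s s >= cbrt (A r r r * A s s s ^+ 2) /\
     A r t t >= cbrt (A r r r * A t t t ^+ 2)) /\
    ([/\ A r r s >= cbrt (A r r r ^+ 2 * A s s s),
         A r r t >= - cbrt (A r r r ^+ 2 * A t t t),
         A s s t >= - cbrt (A s s s ^+ 2 * A t t t) &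
         A s t t >= cbrt (A s s s * A t t t ^+ 2)] \/
     [/\ A r r s >= - cbrt (A r r r ^+ 2 * A s s s),
         A r r t >= 0,
         A s s t >= cbrt (A s s s ^+ 2 * A t t t) &
         A s t t >= cbrt (A s s s * A t t t ^+ 2)] \/
     [/\ A r r s >= 0,
         A r r t >= 0,
         A s s t >= cbrt (A s s s ^+ 2 * A t t t) &
         A s t t >= - cbrt (A s s s * A t t t ^+ 2)] \/
     [/\ A r r s >= cbrt (A r r r ^+ 2 * A s s s),
         A r r t >= - cbrt (A r r r ^+ 2 * A t t t),
         A s s t >= 0 &
         A s t t >= 0] \/
     [/\ A r r s >= 0,
         A r r t >= 0,
         A s s t >= 0 &
         A s t t >= 0])) :
  strictly_copositive A.
Proof.
move=> x x_neq0 x_ge0.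
have [r [s [t [[rs st rt] [[rss rtt] cases]]]]] := condA.
(* The bound on [A 0 1 2] survives relabelling: the entry by symmetry, the diagonal product because
   it runs over all indices. *)
have Arst : A r s t >= - cbrt (A r r r * A s s s * A t t t).
  have [p0 p1 p2] := triple_permE rs st rt.
  have := symA (triple_perm rs st rt) id; rewrite /= p0 p1 p2 => ->.
  have prod3 (B : 'I_3 -> R) (i j k : 'I_3) : i != j -> j != k -> i != k ->
      \prod_l B l = B i * B j * B k.
    by move=> ij jk ik; rewrite (big_triple ij jk ik) /= mulrA.
  by rewrite -(prod3 (fun i => A i i i)) // (prod3 _ 0 1 2).
rewrite (cubic_form3E x symA rs st rt).
have := diagA r; have := diagA s; have := diagA t.
have := x_ge0 r; have := x_ge0 s; have := x_ge0 t.
have : 0 < x r 0 + x s 0 + x t 0.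
  have sumE : \sum_i x i 0 = x r 0 + x s 0 + x t 0.
    by rewrite (big_triple rs st rt) /= addrA.
  rewrite -sumE lt_def sumr_ge0// andbT; apply: contra x_neq0.
  rewrite psumr_eq0// => /allP x0; apply/eqP/matrixP => i j.
  by rewrite (ord1 j) mxE; apply/eqP/x0; rewrite mem_index_enum.
(* From here on only ten entries and three coordinates matter, as plain real numbers. *)
move: rss rtt Arst cases.
move: (A r r r) (A s s s) (A t t t) (A r s s) (A r t t) (A r r s) (A r r t)
  (A s s t) (A s t t) (A r s t) (x r 0) (x s 0) (x t 0).
move=> a3 b3 c3 arss artt arrs arrt asst astt arst xr xs xt.
move=> rss rtt rst cases xsum_gt0 xt_ge0 xs_ge0 xr_ge0.
move=> /gt0_cube_ex[c c_gt0 c3E] /gt0_cube_ex[b b_gt0 b3E] /gt0_cube_ex[a a_gt0 a3E].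
move: rss rtt rst cases; rewrite {}a3E {}b3E {}c3E.
(* The outer [*] pairs two equations, so that a single rewrite evaluates both shapes of mixed cube
   root. *)
have cbrtM (p q : R) : 0 < p -> 0 < q ->
    (cbrt (p ^+ 3 * (q ^+ 3) ^+ 2) = p * q ^+ 2) *
    (cbrt ((p ^+ 3) ^+ 2 * q ^+ 3) = p ^+ 2 * q).
  move=> p_gt0 q_gt0; split; rewrite exprAC -exprMn X3cbrt//.
    by rewrite mulr_ge0 ?exprn_ge0// ltW.
  by rewrite mulr_ge0 ?exprn_ge0// ltW.
have -> : cbrt (a ^+ 3 * b ^+ 3 * c ^+ 3) = a * b * c.
  by rewrite -!exprMn X3cbrt// !mulr_ge0// ltW.
rewrite !cbrtM//.
move=> rss rtt rst cases.
(* In these variables the bounds become coefficients 1, 0 or -1; for instance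
   [a * b ^+ 2 * (xr * xs ^+ 2)] is [u * v ^+ 2]. *)
set u := a * xr; set v := b * xs; set w := c * xt.
have u_ge0 : 0 <= u by rewrite mulr_ge0// ltW.
have v_ge0 : 0 <= v by rewrite mulr_ge0// ltW.
have w_ge0 : 0 <= w by rewrite mulr_ge0// ltW.
have s_gt0 : 0 < u + v + w.
  rewrite lt_def !addr_ge0// andbT; apply/negP.
  rewrite !paddr_eq0 ?addr_ge0// !mulf_eq0.
  rewrite (gt_eqF a_gt0) (gt_eqF b_gt0) (gt_eqF c_gt0) /=.
  case/andP => /andP[/eqP r0 /eqP s0] /eqP t0.
  by move: xsum_gt0; rewrite r0 s0 t0 !addr0 ltxx.
have scale (k l m : R) : 0 <= m -> k <= l -> k * m <= l * m.
  by move=> *; rewrite ler_wpM2r.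
have {}rss := scale _ _ (xr * xs ^+ 2)
  (mulr_ge0 xr_ge0 (exprn_ge0 2 xs_ge0)) rss.
have {}rtt := scale _ _ (xr * xt ^+ 2)
  (mulr_ge0 xr_ge0 (exprn_ge0 2 xt_ge0)) rtt.
have {}rst := scale _ _ (xr * xs * xt)
  (mulr_ge0 (mulr_ge0 xr_ge0 xs_ge0) xt_ge0) rst.
(* The lower bounds of these four entries vary with the case, hence the parameter [k]. *)
have srrs k := @scale k arrs (xr ^+ 2 * xs) (mulr_ge0 (exprn_ge0 2 xr_ge0) xs_ge0).
have srrt k := @scale k arrt (xr ^+ 2 * xt) (mulr_ge0 (exprn_ge0 2 xr_ge0) xt_ge0).
have ssst k := @scale k asst (xs ^+ 2 * xt) (mulr_ge0 (exprn_ge0 2 xs_ge0) xt_ge0).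
have sstt k := @scale k astt (xs * xt ^+ 2) (mulr_ge0 xs_ge0 (exprn_ge0 2 xt_ge0)).
(* In each case the form exceeds the matching ternary cubic by 3 or 6 times the slacks of the scaled
   bounds, which is linear in the monomials. *)
case: cases => [|[|[|[|]]]] [/srrs rrs /srrt rrt /ssst sst /sstt stt].
- have := ternary_cubic1_gt0 u_ge0 v_ge0 w_ge0 s_gt0.
  by rewrite /u /v /w; lra.
- have := ternary_cubic2_gt0 u_ge0 v_ge0 w_ge0 s_gt0.
  by rewrite /u /v /w; lra.
- have := ternary_cubic3_gt0 u_ge0 v_ge0 w_ge0 s_gt0.
  by rewrite /u /v /w; lra.
- have := ternary_cubic4_gt0 u_ge0 v_ge0 w_ge0 s_gt0.
  by rewrite /u /v /w; lra.
- have := ternary_cubic5_gt0 u_ge0 v_ge0 w_ge0 s_gt0.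
  by rewrite /u /v /w; lra.
Qed.
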